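(* For $x\in\mathrm{Dom}(\Phi)$, the following statements are equivalent: (i) The function $u:\mathrm{Gr}(\Phi)\to\overline{\mathbb{R}}$ is lower min-semicontinuous at $x$. (ii) There exists $y^*\in\Phi(x)$ such that every net $((x_\alpha,y_\alpha))_{\alpha\in I}$ in $\mathrm{Gr}(\Phi)$ with $x_\alpha\to x$ satisfies $u(x,y^* )\le\liminf_{\alpha\in I}u(x_\alpha,y_\alpha)$. (iii) The function $u^*:\mathrm{Dom}(\Phi)\to\overline{\mathbb{R}}$ is lower semicontinuous at $x$, and $\Phi^*(x)\ne\emptyset$.
   Context: $X,Y$ are topological spaces, $\Phi:X\to 2^Y$ is a multifunction ($\Phi(x)\subset Y$, possibly empty), $\mathrm{Dom}(\Phi)=\{x\in X:\Phi(x)\ne\emptyset\}$, $\mathrm{Gr}(\Phi)=\{(x,y)\in X\times Y:y\in\Phi(x)\}$, $u:\mathrm{Gr}(\Phi)\to\overline{\mathbb{R}}=\mathbb{R}\cup\{\pm\infty\}$. For $x\in\mathrm{Dom}(\Phi)$: $u^*(x)=\inf_{y\in\Phi(x)}u(x,y)$ and $\Phi^*(x)=\{y\in\Phi(x):u(x,y)=u^*(x)\}$. A neighborhood of $x$ is an open subset of $X$ containing $x$. A function $f:E\to\overline{\mathbb{R}}$ is lower semicontinuous at $z\in E$ if $f(z)\le\liminf_\alpha f(z_\alpha)$ for every net $(z_\alpha)$ in $E$ with $z_\alpha\to z$. Lower min-semicontinuity: $u$ is lower min-semicontinuous at $x\in\mathrm{Dom}(\Phi)$ if there exists $y^*\in\Phi(x)$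 such that for every $\gamma\in\mathbb{R}$ with $u(x,y^* )>\gamma$ there exists a neighborhood $U$ of $x$ such that $u(x',y')>\gamma$ for each $x'\in U$ and $y'\in\Phi(x')$. *)

(* Defs.v *)
From HB Require Import structures.
From mathcomp Require Import all_boot all_order all_algebra.
From mathcomp Require Import all_classical all_reals all_analysis.

Set Implicit Arguments.
Unset Strict Implicit.
Unset Printing Implicit Defensive.

Local Open Scope classical_set_scope.
Local Open Scope ring_scope.
Local Open Scope ereal_scope.

(* A net in T is a function I -> T on a nonempty type I directed by le;
   antisymmetry of le is not required. *)
Record is_directed (I : Type) (le : I -> I -> Prop) : Prop := IsDirected {
  directed_nonempty : [set: I] !=set0 ;
  directed_refl : forall a, le a a ;
  directed_trans : forall a b c, le a b -> le b c -> le a c ;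
  directed_ub : forall a b, exists c, le a c /\ le b c }.

Definition tails (I : Type) (le : I -> I -> Prop) : set_system I :=
  filter_from [set: I] (fun a => [set b | le a b]).

Definition net_cvg (T : topologicalType) (I : Type) (le : I -> I -> Prop)
    (z : I -> T) (t : T) : Prop :=
  z @ tails le --> t.

(* The library's limf_einf is not applicable here: it requires the index type
   to be a filteredType. *)
Definition net_liminf (R : realType) (I : Type) (le : I -> I -> Prop)
    (v : I -> \bar R) : \bar R :=
  ereal_sup [set ereal_inf [set v b | b in [set b | le a b]] | a in [set: I]].

(* The library's lower_semicontinuous is global and stated with
   neighbourhoods. *)
Definition lsc_at (R : realType) (E : topologicalType) (f : E -> \bar R)
    (z : E) : Prop :=
  forall (I : Type) (le : I -> I -> Prop) (s : I -> E), is_directed le ->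
    net_cvg le s z -> f z <= net_liminf le (f \o s).

Definition Dom (X Y : Type) (Phi : X -> set Y) : set X :=
  [set x | Phi x !=set0].

Definition Gr (X Y : Type) (Phi : X -> set Y) : set (X * Y) :=
  [set p | Phi p.1 p.2].

Definition gr_point (X Y : Type) (Phi : X -> set Y) (x : X) (y : Y)
    (h : Phi x y) : Gr Phi :=
  @SigSub _ _ (Gr Phi) (x, y) (mem_set h).

Section minimization.
Variables (R : realType) (X Y : topologicalType) (Phi : X -> set Y).
(* Sets are coerced to subtypes, carrying the subspace topology. *)
Variable u : Gr Phi -> \bar R.

Definition inf_value (x : Dom Phi) : \bar R :=
  ereal_inf [set r | exists (y : Y) (h : Phi (val x) y), r = u (gr_point h)].

Definition argmin (x : Dom Phi) : set Y :=
  [set y | exists h : Phi (val x) y, u (gr_point h) = inf_value x].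

Definition lower_min_semicontinuous_at (x : Dom Phi) : Prop :=
  exists (y0 : Y) (h0 : Phi (val x) y0),
    forall c : R, c%:E < u (gr_point h0) ->
      exists U : set X, [/\ open U, U (val x) &
        forall (x' : X) (y' : Y) (h' : Phi x' y'),
          U x' -> c%:E < u (gr_point h')].

End minimization.

(* Main.v *)
Require Import Defs.
From HB Require Import structures.
From mathcomp Require Import all_boot all_order all_algebra.
From mathcomp Require Import all_classical all_reals all_analysis.

(** Whether along nets or along neighborhoods, semicontinuity compares a value
    m with the values that a function v takes over points near t.  The lemma
    [le_net_liminfP] says so once for all: given p : A -> T, the inequality
    m <= liminf v(z_i) for all nets z in A with p(z_i) --> t means that
    every real c < m is a strict lower bound of v on the p-preimage of some
    neighborhood of t.  With p : Gr Phi -> X the projection this is the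
    equivalence of (i) and (ii), for the same y0; with p the identity of
    Dom Phi it turns the semicontinuity of the value function into a statement
    on neighborhoods.

    It remains to compare (i) with (iii).  Under (i), the point x belongs to
    each of the neighborhoods U, so no value u(x, y) lies below u(x, y0): the
    point y0 is a minimizer and u(x, y0) = u^*(x).  The bound on u over the
    fibers above U then passes to their infima, at the price of inserting a
    second real number between c and u^*(x), since an infimum keeps only large
    inequalities.  Conversely, a lower bound of u^* near x bounds u on all
    the fibers near x, and a minimizer y0 satisfies u(x, y0) = u^*(x). *)

Set Implicit Arguments.
Unset Strict Implicit.

Import Order.TTheory GRing.Theory Num.Theory.

Local Open Scope classical_set_scope.
Local Open Scope ring_scope.
Local Open Scope ereal_scope.

Lemma lt_ereal_dense (R : realType) (a b : \bar R) :
  a < b -> exists2 c : R, a < c%:E & c%:E < b.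
Proof.
case: a b => [r| |] [s| |] //=.
- by move=> rs; exists ((r + s) / 2)%R; rewrite lte_fin midf_lt.
- by move=> _; exists (r + 1)%R; rewrite ?ltry// lte_fin ltrDl.
- by move=> _; exists (s - 1)%R; rewrite ?ltNyr// lte_fin ltrBlDr ltrDl.
- by move=> _; exists 0%R; rewrite ?ltry ?ltNyr.
Qed.

Lemma le_net_liminf (R : realType) (I : Type) (le : I -> I -> Prop)
    (v : I -> \bar R) (c : \bar R) :
  tails le [set b | c <= v b] -> c <= net_liminf le v.
Proof.
move=> [a _ le_cv]; apply: le_trans (ereal_sup_ubound _); last by exists a.
by apply: le_ereal_inf_tmp => _ [b /le_cv ? <-].
Qed.

(** Nets detect uniform lower bounds near a point.  If some real c < m were
    not a strict lower bound on any neighborhood, the pairs of a neighborhood U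
    of t and a point a above U with v(a) <= c would form a net, ordered by
    reverse inclusion of the neighborhoods, with limit t and lower limit at
    most c. *)
Lemma le_net_liminfP (R : realType) (T : topologicalType) (A : Type)
    (p : A -> T) (v : A -> \bar R) (t : T) (m : \bar R) :
  (forall (I : Type) (le : I -> I -> Prop) (z : I -> A), is_directed le ->
     net_cvg le (p \o z) t -> m <= net_liminf le (v \o z)) <->
  (forall c : R, c%:E < m ->
     exists2 U, nbhs t U & p @^-1` U `<=` [set a | c%:E < v a]).
Proof.
split=> [liminf_ge c cm | near_gt I le z dir zt]; last first.
  rewrite leNgt; apply/negP => /lt_ereal_dense[c Lc /near_gt[U Ut vU]].
  suff: c%:E <= net_liminf le (v \o z) by rewrite leNgt Lc.
  apply: le_net_liminf; have [a _ zU] := zt _ Ut.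
  by exists a => // b /zU /vU; apply: ltW.
apply: contrapT => no_nbhs.
have bad U : nbhs t U -> exists2 a, U (p a) & v a <= c%:E.
  move=> Ut; apply: contrapT => no_bad; apply: no_nbhs; exists U => // a Ua /=.
  by rewrite ltNge; apply/negP => va; apply: no_bad; exists a.
pose I := {Ua : set T * A |
  [/\ nbhs t Ua.1, Ua.1 (p Ua.2) & v Ua.2 <= c%:E]}.
pose le (i j : I) := (sval j).1 `<=` (sval i).1.
pose z (i : I) := (sval i).2.
have above U : nbhs t U -> exists i : I, (sval i).1 = U.
  move=> Ut; have [a Ua va] := bad U Ut.
  by exists (exist _ (U, a) (And3 Ut Ua va)).
have dir : is_directed le.
  split.
  - by have [i _] := above _ filterT; exists i.
  - by move=> i.
  - by move=> i j k ij jk; apply: subset_trans ij.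
  - move=> [[U a] [Ut Ua va]] [[V b] [Vt Vb vb]].
    have [k kUV] := above _ (filterI Ut Vt).
    by exists k; split; rewrite /le kUV => s [].
have zt : net_cvg le (p \o z) t.
  move=> U Ut; have [i iU] := above U Ut.
  exists i => // j; rewrite /le /= iU => jU.
  by case: (svalP j) => _ /jU.
have := liminf_ge I le z dir zt; rewrite leNgt => /negP; apply.
apply: le_lt_trans cm; apply: ge_ereal_sup => _ [i _ <-].
apply: le_trans (ereal_inf_lbound _) _; first by exists i.
by case: (svalP i).
Qed.

Lemma nbhs_subtypeP (X : topologicalType) (A : set X) (x : A) (V : set A) :
  nbhs x V <-> exists U : set X,
    [/\ open U, U (val x) & [set a : A | U (val a)] `<=` V].
Proof.
split=> [[_ [[U oU <-] Ux UV]] | [U [oU Ux UV]]].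
  by exists U; split.
by exists [set a : A | U (val a)]; split=> //; exists U.
Qed.

Theorem theorem4 (R : realType) (X Y : topologicalType) (Phi : X -> set Y)
    (u : Gr Phi -> \bar R) (x : Dom Phi) :
  let cond_i := lower_min_semicontinuous_at u x in
  let cond_ii :=
    exists (y0 : Y) (h0 : Phi (val x) y0),
      forall (I : Type) (le : I -> I -> Prop) (z : I -> Gr Phi),
        is_directed le ->
        net_cvg le (fun a => (val (z a)).1) (val x) ->
        u (gr_point h0) <= net_liminf le (u \o z) in
  let cond_iii :=
    lsc_at (inf_value u) x /\ argmin u x !=set0 in
  (cond_i <-> cond_ii) /\ (cond_ii <-> cond_iii).
Proof.
move=> ci cii ciii.
pose prX (g : Gr Phi) : X := (val g).1.
have inf_le (x' : Dom Phi) y (h : Phi (val x') y) :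
    inf_value u x' <= u (gr_point h).
  by apply: ereal_inf_lbound; exists y, h.
have i_ii : ci <-> cii.
  split=> -[y0 [h0 H]]; exists y0, h0.
    apply/(le_net_liminfP prX) => c /H[U [oU Ux uU]].
    exists U; first exact: open_nbhs_nbhs.
    move=> [[x' y'] h'] /= Ux'.
    have h : Phi x' y' := set_mem h'.
    by rewrite (_ : exist _ _ _ = gr_point h); [exact: uU | exact: val_inj].
  move=> c cu.
  have /(le_net_liminfP prX)/(_ c cu)[U] := H.
  rewrite nbhsE => -[V [oV Vx] VU] uU.
  by exists V; split=> // x' y' h' /VU Ux'; apply: (uU (gr_point h')).
split=> //; rewrite -i_ii; split.
- move=> [y0 [h0 H]].
  have inf_x : u (gr_point h0) = inf_value u x.
    apply/eqP; rewrite eq_le inf_le andbT.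
    apply: le_ereal_inf_tmp => _ [y [h ->]].
    rewrite leNgt; apply/negP => /lt_ereal_dense[c uc /H[U [_ Ux /(_ _ _ h Ux)]]].
    by rewrite ltNge ltW.
  split; last by exists y0, h0.
  apply/(le_net_liminfP idfun) => c.
  rewrite -inf_x => /lt_ereal_dense[d cd /H[U [oU Ux uU]]].
  exists [set x' : Dom Phi | U (val x')].
    by apply/nbhs_subtypeP; exists U; split.
  move=> x' Ux' /=; apply: lt_le_trans cd _.
  by apply: le_ereal_inf_tmp => _ [y [h ->]]; apply/ltW/uU.
- move=> [lsc [y0 [h0 inf_x]]]; exists y0, h0 => c; rewrite inf_x => cu.
  have /(le_net_liminfP idfun)/(_ c cu)[V] := lsc.
  move=> /nbhs_subtypeP[U [oU Ux UV]] uV.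
  exists U; split=> // x' y' h' Ux'.
  pose d : Dom Phi := SigSub (mem_set (ex_intro _ y' h' : Dom Phi x')).
  exact: lt_le_trans (uV d (UV d Ux')) (inf_le d y' h').
Qed.
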